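(* On the class $\mathsf{Cycles}$ of finite disjoint unions of (undirected) cycles, the orders $(\mathsf{Cycles},\leq^{LB})$, $(\mathsf{Cycles},\leq^{LS})$ and $(\mathsf{Cycles},\leq^{LI})$ coincide, and this order is universal.
   Context: $C_k$ ($k\geq3$) is the undirected cycle with $k$ vertices; $\mathsf{Cycles}$ is the class of graphs that are disjoint unions of finitely many cycles $C_k$, $k\ge 3$. $N_G(v)$ is the set of vertices adjacent to $v$. A graph homomorphism $f:G\to H$ is locally injective (LI), locally surjective (LS), or locally bijective (LB) if for every $v\in V_G$ the restriction of $f$ to $N_G(v)\to N_H(f(v))$ is injective, surjective, or bijective, respectively. $G\leq^{LI}H$, $G\leq^{LS}H$, $G\leq^{LB}H$ denote the existence of such a homomorphism from $G$ to $H$. These quasi-orders are regarded as partial orders by identifying equivalent graphs ($G\leq H\leq G$). A countable partial order is universal if every countable partial order $(P,\leq_P)$ embeds into it, i.e. there is a map $E$ with $a\leq_P b\iff E(a)\leq E(b)$ for all $a,b\in P$. *)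

(* Defs.v *)
From Stdlib Require Import Relation_Definitions.
From mathcomp Require Import all_boot.

Set Implicit Arguments.
Unset Strict Implicit.
Unset Printing Implicit Defensive.

Record graph := Graph {
  vertex :> finType;
  adj : rel vertex;
  adj_sym : symmetric adj;
  adj_irr : irreflexive adj
}.

Definition nbhd (G : graph) (v : G) : {set G} := [set w | adj v w].

(* [ordS] is the successor modulo [k].  The conjunct [i != j] only matters
   for [k = 1], where it removes the loop. *)
Definition cycle_adj (k : nat) : rel 'I_k :=
  fun i j => (i != j) && ((j == ordS i) || (i == ordS j)).

Lemma cycle_adj_sym k : symmetric (@cycle_adj k).
Proof. by move=> i j; rewrite /cycle_adj eq_sym orbC. Qed.

Lemma cycle_adj_irr k : irreflexive (@cycle_adj k).
Proof. by move=> i; rewrite /cycle_adj eqxx. Qed.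

Definition cycle_graph (k : nat) : graph :=
  Graph (@cycle_adj_sym k) (@cycle_adj_irr k).

Section DisjointUnion.
Variables (n : nat) (G : 'I_n -> graph).

Definition dunion_adj : rel {i : 'I_n & G i} :=
  fun x y => (tag x == tag y) && adj (tagged x) (tagged_as x y).

Lemma dunion_adj_sym : symmetric dunion_adj.
Proof.
move=> [i x] [j y]; rewrite /dunion_adj /=.
case: (eqVneq i j) => [eij|//] /=.
by case: j / eij y => y; rewrite !tagged_asE adj_sym.
Qed.

Lemma dunion_adj_irr : irreflexive dunion_adj.
Proof. by move=> [i x]; rewrite /dunion_adj /= eqxx tagged_asE adj_irr. Qed.

Definition dunion : graph := Graph dunion_adj_sym dunion_adj_irr.

End DisjointUnion.

Definition graph_iso (G H : graph) : Prop :=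
  exists2 f : G -> H, bijective f & forall u v, adj (f u) (f v) = adj u v.

Definition Cycles (G : graph) : Prop :=
  exists (n : nat) (k : 'I_n -> nat),
    (forall i, 3 <= k i) /\ graph_iso G (dunion (fun i => cycle_graph (k i))).

Section LocalConstraints.
Variables (G H : graph) (f : G -> H).

Definition homomorphism : Prop := forall u v, adj u v -> adj (f u) (f v).

Definition locally_injective : Prop := forall v, {in nbhd v &, injective f}.

Definition locally_surjective : Prop :=
  forall v, {in nbhd (f v), forall w, exists2 u, u \in nbhd v & f u = w}.

Definition locally_bijective : Prop :=
  forall v, {in nbhd v &, injective f} /\
            {in nbhd (f v), forall w, exists2 u, u \in nbhd v & f u = w}.

End LocalConstraints.

Definition le_LI : relation graph := fun G H =>
  exists2 f : G -> H, homomorphism f & locally_injective f.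

Definition le_LS : relation graph := fun G H =>
  exists2 f : G -> H, homomorphism f & locally_surjective f.

Definition le_LB : relation graph := fun G H =>
  exists2 f : G -> H, homomorphism f & locally_bijective f.

Section Quotient.
Variables (T : Type) (D : T -> Prop) (le : relation T).

(* Equivalence classes, inside the class [D], of [x ~ y := x <= y <= x]. *)
Definition quot : Type :=
  {C : T -> Prop |
    exists2 x, D x & forall y, C y <-> D y /\ le x y /\ le y x}.

Definition quot_le : relation quot := fun C1 C2 =>
  exists x y, sval C1 x /\ sval C2 y /\ le x y.

End Quotient.

Definition countable_type (T : Type) : Prop :=
  exists f : T -> nat, injective f.

(* [order] is the standard library's reflexive, transitive, antisymmetric. *)
Definition countable_order (P : Type) (leP : relation P) : Prop :=
  countable_type P /\ Relation_Definitions.order P leP.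

Definition universal (U : Type) (leU : relation U) : Prop :=
  countable_order leU /\
  forall (P : Type) (leP : relation P), countable_order leP ->
    exists E : P -> U, forall a b, leP a b <-> leU (E a) (E b).

(* Main.v *)
(** Every vertex of a disjoint union of cycles has degree two, so a homomorphism
    between two such graphs is injective on a neighbourhood iff it is surjective
    there: the three orders coincide.  A locally injective homomorphism sends a
    walk around [C_k] to a closed walk that never backtracks, hence runs around
    its target cycle [C_l] in a constant direction and closes up only if [l]
    divides [k]; conversely reduction modulo [l] wraps [C_k] around [C_l].  So
    the order compares finite sets of integers [>= 3] by "every element of the
    left set has a divisor in the right set".

    Given a countable preorder [r], enumerated by the integers, put
    [m_i = \prod_(j <= i | r i j) p_j] for distinct odd primes [p_j] (below, a
    least common multiple), and send [k] to [{m_i | i <= k, r i k}].  If [r a b]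
    and [m_i] lies in the set of [a], then either [i <= b] and [m_i] lies in the
    set of [b], or [b < i] and [m_b] divides [m_i].  If [m_a] has a divisor
    [m_i] in the set of [b], then [p_i] divides [m_a], whence [r a i] and
    [r i b]. *)

From Stdlib Require Import Relation_Definitions.
From mathcomp Require Import all_boot.
From mathcomp Require Import boolp.
Require Import Defs.

Set Implicit Arguments.
Unset Strict Implicit.
Unset Printing Implicit Defensive.

(** * Local constraints and degree two *)

Definition regular2 (G : graph) : Prop := forall v : G, #|nbhd v| = 2.

Lemma in_nbhd (G : graph) (v w : G) : (w \in nbhd v) = adj v w.
Proof. by rewrite inE. Qed.

Lemma le_LBW (G H : graph) : le_LB G H -> le_LS G H /\ le_LI G H.
Proof.
by case=> f homf lbf; split; exists f => // v; case: (lbf v).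
Qed.

Section Regular.
Variables (G H : graph) (f : G -> H).
Hypotheses (G2 : regular2 G) (H2 : regular2 H) (homf : homomorphism f).

Lemma imset_nbhd_sub v : f @: nbhd v \subset nbhd (f v).
Proof.
by apply/subsetP=> _ /imsetP[u + ->]; rewrite !in_nbhd => /homf.
Qed.

Lemma locally_injective_bijective : locally_injective f -> locally_bijective f.
Proof.
move=> lif v; split=> [|w]; first exact: lif.
have -> : nbhd (f v) = f @: nbhd v.
  by apply/esym/eqP; rewrite eqEcard imset_nbhd_sub H2 card_in_imset ?G2 //; exact: lif.
by case/imsetP=> u uv ->; exists u.
Qed.

(** The image of [nbhd v] covers two vertices and comes from two, so no two neighbours are
    merged. *)
Lemma locally_surjective_bijective : locally_surjective f -> locally_bijective f.
Proof.
move=> lsf v; split=> [|w]; last exact: lsf.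
apply/imset_injP; rewrite G2 eqn_leq -{1}(G2 v) leq_imset_card -(H2 (f v)).
by apply/subset_leq_card/subsetP=> w /lsf[u uv <-]; exact: imset_f.
Qed.

End Regular.

Lemma graph_iso_regular2 (G H : graph) :
  graph_iso G H -> regular2 H -> regular2 G.
Proof.
case=> f [g fK gK] adjf H2 v; rewrite -(H2 (f v)).
rewrite -(card_imset _ (can_inj fK)); apply: eq_card => w.
rewrite -[w]gK (mem_imset _ _ (can_inj fK)) !in_nbhd; exact/esym/adjf.
Qed.

(** * Disjoint unions of cycles *)

Lemma ordSE k (i : 'I_k) : ordS i = i.+1 %% k :> nat.
Proof. by []. Qed.

Lemma ordS_inj k : injective (@ordS k).
Proof. exact: can_inj (@ordSK k). Qed.

Lemma val_iter_ordS k n (i : 'I_k) : iter n (@ordS k) i = (i + n) %% k :> nat.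
Proof.
elim: n => [|n IHn]; first by rewrite addn0 modn_small.
by rewrite iterS ordSE IHn -addn1 modnDml addn1 addnS.
Qed.

Lemma iter_ordS_id k n (i : 'I_k) : iter n (@ordS k) i = i -> k %| n.
Proof.
move/(congr1 val); rewrite /= val_iter_ordS -[RHS](modn_small (ltn_ord i)).
by move/eqP; rewrite -{2}[nat_of_ord i]addn0 eqn_modDl mod0n.
Qed.

Lemma iter_ordS_neq k n (i : 'I_k) : 0 < n < k -> iter n (@ordS k) i != i.
Proof.
by case/andP=> n0 nk; apply/eqP=> /iter_ordS_id /(dvdn_leq n0); rewrite leqNgt nk.
Qed.

Lemma nbhd_cycle k (i : cycle_graph k) : 2 < k ->
  nbhd i = [set ordS i; ord_pred i].
Proof.
move=> k3; apply/setP=> j; rewrite in_nbhd !inE /= /cycle_adj.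
have -> : (i == ordS j) = (j == ord_pred i).
  by apply/eqP/eqP=> ->; rewrite ?ordSK ?ord_predK.
have [ij|//] := eqVneq i j; rewrite -ij; apply/esym/norP; split.
  by rewrite eq_sym; apply: (@iter_ordS_neq k 1); rewrite (ltn_trans _ k3).
rewrite -(inj_eq (@ordS_inj k)) ord_predK.
by apply: (@iter_ordS_neq k 1); rewrite (ltn_trans _ k3).
Qed.

Lemma cycle_regular2 k : 2 < k -> regular2 (cycle_graph k).
Proof.
(* Successor and predecessor are two steps apart, hence distinct once [k] exceeds 2. *)
move=> k3 i; rewrite nbhd_cycle // cards2 -(inj_eq (@ordS_inj k)) ord_predK.
by rewrite (@iter_ordS_neq k 2).
Qed.

Lemma nbhd_dunion n (G : 'I_n -> graph) i (x : G i) :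
  nbhd (Tagged G x : dunion G) = Tagged G @: nbhd x.
Proof.
apply/setP=> w; apply/idP/imsetP=> [|[z + ->]]; rewrite !in_nbhd; last first.
  by rewrite /= /dunion_adj /= eqxx tagged_asE.
case: w => j y /andP[/eqP /= ij]; case: j / ij y => y.
by rewrite tagged_asE => xy; exists y; rewrite ?in_nbhd.
Qed.

Lemma dunion_regular2 n (G : 'I_n -> graph) :
  (forall i, regular2 (G i)) -> regular2 (dunion G).
Proof.
move=> G2 [i x]; rewrite (nbhd_dunion x) card_imset ?G2 //; exact: eq_from_Tagged.
Qed.

Notation cycles k := (dunion (fun i => cycle_graph (k i))).

Lemma cycles_regular2 n (k : 'I_n -> nat) :
  (forall i, 2 < k i) -> regular2 (cycles k).
Proof. by move=> k3; apply: dunion_regular2 => i; apply: cycle_regular2. Qed.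

Lemma Cycles_regular2 G : Cycles G -> regular2 G.
Proof.
by case=> n [k [k3 /graph_iso_regular2]]; apply; apply: cycles_regular2.
Qed.

Lemma Cycles_cycles n (k : 'I_n -> nat) : (forall i, 2 < k i) -> Cycles (cycles k).
Proof.
by move=> k3; exists n, k; split=> //; exists id => //; exists id.
Qed.

(** * The order is divisibility *)

(** Opposite consecutive steps would give [y t.+2 = y t], so the first step fixes the direction. For
    a backward walk, the [S]-orbit of [y k] leads to [y 0], and these two coincide. *)
Lemma nonbacktracking_closed_walk (T : Type) (S : T -> T) (y : nat -> T) k :
    injective S ->
    (forall t, y t.+1 = S (y t) \/ y t = S (y t.+1)) ->
    (forall t, y t.+2 <> y t) -> y k = y 0 ->
  iter k S (y 0) = y 0.
Proof.
move=> injS adjy nby yk.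
case: (adjy 0) => y1.
  have yS t : y t.+1 = S (y t).
    elim: t => // t IHt; case: (adjy t.+1) => // yt.
    by case: (nby t); apply: injS; rewrite -yt.
  rewrite -[RHS]yk; elim: k {yk} => // k IHk.
  by rewrite iterS IHk -yS.
have yS t : y t = S (y t.+1).
  elim: t => // t IHt; case: (adjy t.+1) => // yt.
  by case: (nby t); rewrite yt -IHt.
rewrite -{1}yk; elim: k {yk} => // k IHk.
by rewrite iterSr -yS.
Qed.

Section CyclesOrder.
Variables (n m : nat) (k : 'I_n -> nat) (l : 'I_m -> nat).
Hypotheses (k3 : forall i, 2 < k i) (l3 : forall j, 2 < l j).

Lemma le_LB_dvdn : le_LB (cycles k) (cycles l) -> forall i, exists j, l j %| k i.
Proof.
case=> f homf lbf i.
(* [S] rotates all target cycles at once, so the walk can be followed before its component is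
   known. *)
pose S (u : cycles l) : cycles l := Tagged (fun j => 'I_(l j)) (ordS (tagged u)).
pose S' (u : cycles l) : cycles l := Tagged (fun j => 'I_(l j)) (ord_pred (tagged u)).
have injS : injective S by apply: (can_inj (g := S')) => -[j x]; rewrite /S /S' /= ordSK.
have adjS (u v : cycles l) : adj u v -> v = S u \/ u = S v.
  case: u v => [j x] [j' y] /=; rewrite /dunion_adj /= => /andP[/eqP jj'].
  case: j' / jj' y => y; rewrite tagged_asE /= /cycle_adj => /andP[_].
  by case/orP=> /eqP ->; [left|right].
pose i0 : 'I_(k i) := Ordinal (ltn_trans (isT : 0 < 2) (k3 i)).
pose x t : cycles k := Tagged (fun j => 'I_(k j)) (iter t (@ordS (k i)) i0).
have adjx t : adj (x t) (x t.+1).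
  rewrite /= /dunion_adj /= eqxx tagged_asE /= /cycle_adj eqxx andbT eq_sym.
  by apply: (@iter_ordS_neq _ 1); rewrite (ltn_trans _ (k3 i)).
have fxk : f (x (k i)) = f (x 0).
  congr (f _); congr (Tagged _ _); apply: val_inj.
  by rewrite /= val_iter_ordS modnn.
have : iter (k i) S (f (x 0)) = f (x 0).
  apply: (@nonbacktracking_closed_walk _ S (f \o x)) => // t /=; first exact/adjS/homf.
  (* [x t] and [x t.+2] are neighbours of [x t.+1]. If their images agreed, local injectivity would
     identify them, contradicting [2 < k i]. *)
  move/(proj1 (lbf (x t.+1))); rewrite !in_nbhd adjx adj_sym adjx => /(_ isT isT) xt.
  have /eqP[] := @iter_ordS_neq _ 2 (iter t (@ordS _) i0) (k3 i).
  exact: (@eq_from_Tagged _ (fun j => 'I_(k j))) xt.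
case: (f (x 0)) => j y /= yk; exists j.
apply: (@iter_ordS_id _ _ y); apply: (@eq_from_Tagged _ (fun j => 'I_(l j))).
rewrite -[RHS]yk; elim: (k i) {yk fxk} => // t IHt.
by rewrite !iterS -IHt.
Qed.

Lemma dvdn_le_LB : (forall i, exists j, l j %| k i) -> le_LB (cycles k) (cycles l).
Proof.
case/choice=> h hdvd.
have l0 j : 0 < l j by apply: ltn_trans (l3 j).
pose wrap i (x : 'I_(k i)) : 'I_(l (h i)) := Ordinal (ltn_pmod x (l0 (h i))).
have wrapS i (x : 'I_(k i)) : wrap i (ordS x) = ordS (wrap i x).
  apply: val_inj; rewrite /= modn_dvdm //.
  by rewrite -addn1 -[in RHS]addn1 modnDml.
pose f (u : cycles k) : cycles l := Tagged (fun j => 'I_(l j)) (wrap (tag u) (tagged u)).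
have homf : homomorphism f.
  move=> [i x] [i' y] /=; rewrite /dunion_adj /= => /andP[/eqP ii'].
  case: i' / ii' y => y; rewrite eqxx !tagged_asE /= /cycle_adj => /andP[_].
  have neqS (z : 'I_(l (h i))) : ordS z != z.
    by apply: (@iter_ordS_neq _ 1); rewrite (ltn_trans _ (l3 _)).
  by case/orP=> /eqP ->; rewrite wrapS eqxx ?orbT andbT // eq_sym.
exists f => //; apply: locally_injective_bijective => //; try exact: cycles_regular2.
case=> i x; rewrite (nbhd_dunion (G := fun i => cycle_graph (k i)) x).
move=> _ _ /imsetP[y + ->] /imsetP[z + ->]; rewrite !nbhd_cycle // => yx zx.
move=> /(@eq_from_Tagged _ (fun j => 'I_(l j)) (h i)) yz; congr (Tagged _ _); move: yx zx yz.
(* The two neighbours of [x] stay two steps apart in a target cycle of length at least 3. *)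
have wpred : wrap i (ordS x) != wrap i (ord_pred x).
  rewrite -{1}[x]ord_predK !wrapS.
  exact: (@iter_ordS_neq _ 2 _ (l3 _)).
by rewrite !inE => /orP[]/eqP-> /orP[]/eqP-> // /eqP;
  rewrite ?(negPf wpred) // eq_sym (negPf wpred).
Qed.

End CyclesOrder.

Lemma le_LB_refl G : le_LB G G.
Proof. by exists id => // v; split=> // w vw; exists w. Qed.

Lemma le_LB_trans H G K : le_LB G H -> le_LB H K -> le_LB G K.
Proof.
case=> f homf lbf [g homg lbg]; exists (g \o f) => [u v /homf /homg //|v].
have [injf surf] := lbf v; have [injg surg] := lbg (f v); split.
  move=> u w uv wv /= /injg; rewrite !in_nbhd in uv wv *.
  by move=> /(_ (homf _ _ uv) (homf _ _ wv)) /injf; rewrite !in_nbhd; apply.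
by move=> w /= /surg[u /surf[t tv <-] <-]; exists t.
Qed.

Lemma graph_iso_le_LB G H : graph_iso G H -> le_LB G H /\ le_LB H G.
Proof.
case=> f [g fK gK] adjf; split.
  exists f => [u v|v]; first by rewrite adjf.
  split=> [u w _ _ /(can_inj fK) //|w].
  by rewrite in_nbhd -{1}[w]gK adjf => vw; exists (g w); rewrite ?in_nbhd.
exists g => [u v|v]; first by rewrite -adjf !gK.
split=> [u w _ _ /(can_inj gK) //|w].
by rewrite in_nbhd -adjf gK => vw; exists (f w); rewrite ?in_nbhd.
Qed.

(** A normal form by countable data: it serves both to count the classes and to receive the
    embedding. *)
Definition cycles_seq (s : seq nat) : graph := cycles (fun i : 'I_(size s) => nth 0 s i).

Lemma Cycles_cycles_seq s : all (leq 3) s -> Cycles (cycles_seq s).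
Proof. by move=> s3; apply: Cycles_cycles => i; apply: (all_nthP 0 s3). Qed.

Lemma le_LB_cycles_seq s t : all (leq 3) s -> all (leq 3) t ->
  le_LB (cycles_seq s) (cycles_seq t) <->
  {in s, forall a, exists2 b, b \in t & b %| a}.
Proof.
move=> /(all_nthP 0) s3 /(all_nthP 0) t3; split=> [le_st a /(nthP 0)[i si <-]|st].
  have [|j dvd_j] := le_LB_dvdn _ le_st (Ordinal si); first by move=> i'; apply: s3.
  by exists (nth 0 t j); rewrite ?mem_nth.
apply: dvdn_le_LB => i; [exact: s3|exact: t3|].
have /st[_ /(nthP 0)[j tj <-] dvd_j] : nth 0 s i \in s by rewrite mem_nth.
by exists (Ordinal tj).
Qed.

Lemma Cycles_seq G : Cycles G ->
  exists s, [/\ all (leq 3) s, le_LB G (cycles_seq s) & le_LB (cycles_seq s) G].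
Proof.
case=> n [k [k3 /graph_iso_le_LB[leGk lekG]]].
pose s := [seq k i | i <- enum 'I_n].
have s3 : all (leq 3) s by apply/allP=> _ /mapP[i _ ->]; apply: k3.
have snth (i : 'I_(size s)) : exists j, nth 0 s i = k j.
  have /mapP[j _ ->] : nth 0 s i \in s by rewrite mem_nth.
  by exists j.
have s3' (i : 'I_(size s)) : 2 < nth 0 s i by apply: (all_nthP 0 s3).
(* Both families have the same set of lengths, and each length divides itself, so the divisibility
   criterion applies both ways. *)
exists s; split=> //.
  apply: le_LB_trans leGk _; apply: dvdn_le_LB => // i.
  have /(nthP 0)[j sj <-] : k i \in s by rewrite map_f ?mem_enum.
  by exists (Ordinal sj).
apply: le_LB_trans lekG; apply: dvdn_le_LB => // i.
by have [j ->] := snth i; exists j.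
Qed.

(** * The quotient order *)

Section Quotient.
Variables (T : Type) (D : T -> Prop) (le : relation T).
Hypotheses (le_refl : forall x, le x x)
           (le_trans : forall y x z, le x y -> le y z -> le x z).
Local Notation Q := (quot D le).

Definition quot_class (x : T) (Dx : D x) : Q :=
  exist _ (fun y => D y /\ le x y /\ le y x) (ex_intro2 _ _ x Dx (fun y => iff_refl _)).

Lemma quot_le_class x y (Dx : D x) (Dy : D y) :
  quot_le (quot_class Dx) (quot_class Dy) <-> le x y.
Proof.
split=> [[x' [y' [[_ [xx' _]] [[_ [_ y'y]] x'y']]]]|xy].
  exact: le_trans xx' (le_trans x'y' y'y).
by exists x, y; split; [|split].
Qed.

Lemma quot_mem_eqv (C : Q) x : sval C x ->
  forall y, sval C y <-> D y /\ le x y /\ le y x.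
Proof.
case: C => C [z Dz CE] /= /CE[Dx [zx xz]] y; rewrite CE; split.
  by case=> Dy [zy yz]; split=> //; split; apply: le_trans; eassumption.
by case=> Dy [xy yx]; split=> //; split; apply: le_trans; eassumption.
Qed.

Lemma quot_mem_ex (C : Q) : exists x, D x /\ sval C x.
Proof. by case: C => C [x Dx CE]; exists x; split=> //=; rewrite CE. Qed.

Lemma quot_eq (C1 C2 : Q) x y :
  sval C1 x -> sval C2 y -> le x y -> le y x -> C1 = C2.
Proof.
move=> C1x C2y xy yx.
have [Dx _] := (quot_mem_eqv C1x x).1 C1x.
have C2x : sval C2 x by apply/(quot_mem_eqv C2y).
have eqC : sval C1 = sval C2.
  by apply/funext=> z; apply/propext; rewrite (quot_mem_eqv C1x) (quot_mem_eqv C2x).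
(* The predicates agree; the attached proofs agree by proof irrelevance. *)
case: C1 C2 eqC {C1x C2y C2x} => [C1 H1] [C2 H2] /= eqC.
by case: C2 / eqC H2 => H2; congr exist; apply: Prop_irrelevance.
Qed.

Lemma quot_order : Relation_Definitions.order Q (@quot_le T D le).
Proof.
split=> [C|C2 C1 C3|C1 C2].
- by have [x [_ Cx]] := quot_mem_ex C; exists x, x.
- case=> x [y [C2x [C1y xy]]] [y' [z [C1y' [C3z y'z]]]].
  exists x, z; split=> //; split=> //.
  have [_ [yy' _]] := (quot_mem_eqv C1y y').1 C1y'.
  exact: le_trans xy (le_trans yy' y'z).
case=> x [y [C1x [C2y xy]]] [y' [x' [C2y' [C1x' y'x']]]].
apply: (quot_eq C1x C2y) => //.
have [_ [yy' _]] := (quot_mem_eqv C2y y').1 C2y'.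
have [_ [_ x'x]] := (quot_mem_eqv C1x x').1 C1x'.
exact: le_trans yy' (le_trans y'x' x'x).
Qed.

End Quotient.

(** Choose in each class a member [cycles_seq s]; since [s] determines the class, pickling [s] is
    injective. *)
Lemma countable_quot_Cycles : countable_type (quot Cycles le_LB).
Proof.
have /choice[c cP] (C : quot Cycles le_LB) :
    exists s, all (leq 3) s /\ sval C (cycles_seq s).
  have [x [Dx Cx]] := quot_mem_ex le_LB_refl C.
  have [s [s3 xs sx]] := Cycles_seq Dx; exists s; split=> //.
  by apply/(quot_mem_eqv le_LB_trans Cx); split=> //; apply: Cycles_cycles_seq.
exists (pickle \o c) => C1 C2 /(pcan_inj pickleK) eqc.
have [_ C1c] := cP C1; have [_ C2c] := cP C2.
by apply: (quot_eq le_LB_trans C1c C2c); rewrite eqc; apply: le_LB_refl.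
Qed.

(** * Embedding countable preorders into divisibility of finite sets *)

(** Starting at 3 makes every nontrivial code a legal cycle length. Each term is some larger prime,
    not necessarily the next one. *)
Fixpoint odd_prime (i : nat) : nat :=
  if i is j.+1 then s2val (prime_above (odd_prime j)) else 3.

Lemma odd_prime_ltS i : odd_prime i < odd_prime i.+1.
Proof. exact: s2valP (prime_above _). Qed.

Lemma odd_prime_prime i : prime (odd_prime i).
Proof. by case: i => // i; exact: s2valP' (prime_above _). Qed.

Lemma odd_prime_ge3 i : 2 < odd_prime i.
Proof. by elim: i => // i IHi; apply: ltn_trans (odd_prime_ltS i). Qed.

Lemma odd_prime_inj : injective odd_prime.
Proof.
have lt_p : {homo odd_prime : i j / i < j}.
  by apply: homo_ltn odd_prime_ltS; exact: ltn_trans.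
by move=> i j pij; case: (ltngtP i j) => // /lt_p; rewrite pij ltnn.
Qed.

Section Codes.
Variable r : rel nat.
Hypotheses (r_refl : reflexive r) (r_trans : transitive r).

Definition up_code (i : nat) : nat := \big[lcmn/1]_(j < i.+1 | r i j) odd_prime j.

Definition down_codes (k : nat) : seq nat :=
  [seq up_code i | i <- iota 0 k.+1 & r i k].

Lemma odd_prime_dvd_up_code i j : odd_prime j %| up_code i = (j <= i) && r i j.
Proof.
apply/idP/andP=> [|[ji rij]]; last first.
  exact: (@biglcmn_sup _ (Ordinal (ji : j < i.+1)) (fun j => r i j) (fun j => odd_prime j)).
(* A prime dividing an lcm divides the product, hence one of the arguments; this reduces to a single
   [odd_prime t], where injectivity gives [j = t]. *)
rewrite /up_code; elim/big_ind: _ => [|x y IHx IHy|t rit].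
- by rewrite dvdn1 => /eqP pj; have := odd_prime_ge3 j; rewrite pj.
- move=> p_lcm; have : odd_prime j %| x * y.
    by apply: dvdn_trans p_lcm _; rewrite dvdn_lcm dvdn_mulr ?dvdn_mull.
  by rewrite Euclid_dvdM ?odd_prime_prime // => /orP[].
rewrite dvdn_prime2 ?odd_prime_prime // => /eqP/odd_prime_inj ->.
by rewrite -ltnS.
Qed.

Lemma up_code_dvd i j : r i j -> j <= i -> up_code j %| up_code i.
Proof.
move=> rij ji; apply/dvdn_biglcmP=> t rjt.
have tj : t <= j by rewrite -ltnS.
by rewrite odd_prime_dvd_up_code (leq_trans tj ji) (r_trans rij rjt).
Qed.

Lemma mem_down_codes i k : i <= k -> r i k -> up_code i \in down_codes k.
Proof. by move=> ik rik; rewrite map_f // mem_filter rik mem_iota. Qed.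

Lemma down_codesP x k :
  x \in down_codes k -> exists i, [/\ i <= k, r i k & x = up_code i].
Proof.
by case/mapP=> i; rewrite mem_filter mem_iota => /andP[rik ik] ->; exists i.
Qed.

(** By reflexivity [odd_prime i] divides [up_code i], which is positive. *)
Lemma down_codes_ge3 k : all (leq 3) (down_codes k).
Proof.
apply/allP=> _ /down_codesP[i [_ _ ->]].
apply: leq_trans (odd_prime_ge3 i) _; apply: dvdn_leq.
  by rewrite /up_code; elim/big_ind: _ => // [x y x0 y0|t _];
    rewrite ?lcmn_gt0 ?x0 ?y0 // prime_gt0 ?odd_prime_prime.
by rewrite odd_prime_dvd_up_code leqnn r_refl.
Qed.

Lemma down_codes_dvd a b :
  r a b <-> {in down_codes a, forall x, exists2 y, y \in down_codes b & y %| x}.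
Proof.
split=> [rab _ /down_codesP[i [ia ria ->]]|dvd_ab].
  have rib := r_trans ria rab.
  have [ib|/ltnW bi] := leqP i b; first by exists (up_code i); rewrite ?mem_down_codes.
  by exists (up_code b); rewrite ?mem_down_codes ?up_code_dvd.
have [_ /down_codesP[i [_ rib ->]] dvd_i] := dvd_ab _ (mem_down_codes (leqnn a) (r_refl a)).
have : odd_prime i %| up_code a.
  by apply: dvdn_trans dvd_i; rewrite odd_prime_dvd_up_code leqnn r_refl.
by rewrite odd_prime_dvd_up_code => /andP[_ rai]; apply: r_trans rai rib.
Qed.

End Codes.

Theorem corollary5p7p7 :
  (forall G H : graph, Cycles G -> Cycles H ->
     (le_LB G H <-> le_LS G H) /\ (le_LB G H <-> le_LI G H)) /\
  universal (@quot_le graph Cycles le_LB).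
Proof.
split=> [G H /Cycles_regular2 G2 /Cycles_regular2 H2|].
  split; split=> [/le_LBW[]//|[f homf lf]]; exists f => //.
    exact: locally_surjective_bijective.
  exact: locally_injective_bijective.
split.
  split; first exact: countable_quot_Cycles.
  by apply: quot_order; [exact: le_LB_refl|exact: le_LB_trans].
move=> P leP [[f injf] [leP_refl leP_trans _]].
(* The order is transported along [f]; the clause [i = j] keeps [r] reflexive at integers outside
   the range of [f]. *)
pose r : rel nat :=
  fun i j => `[< i = j \/ exists a b, [/\ f a = i, f b = j & leP a b] >].
have r_refl : reflexive r by move=> i; apply/asboolP; left.
have r_trans : transitive r.
  move=> j i t /asboolP[->//|[a [b [fa fb ab]]]] /asboolP[<-|[b' [c [fb' fc bc]]]].
    by apply/asboolP; right; exists a, b.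
  apply/asboolP; right; exists a, c; split=> //; apply: leP_trans ab _.
  by rewrite (injf b b') // fb.
have rf a b : leP a b <-> r (f a) (f b).
  split=> [ab|/asboolP[/injf ->|[a' [b' [/injf <- /injf <-]]]]//].
  by apply/asboolP; right; exists a, b.
exists (fun a => quot_class le_LB (Cycles_cycles_seq (down_codes_ge3 r_refl (f a)))) => a b.
rewrite rf (down_codes_dvd r_refl r_trans) quot_le_class; last first.
- exact: le_LB_trans.
- exact: le_LB_refl.
by rewrite le_LB_cycles_seq ?down_codes_ge3.
Qed.
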